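(* Let $M$ be a $\sigma$-effect monoid. Then the category $\boldsymbol{\sigma}\mathbf{WMod}_M$ of $\sigma$-weight $M$-modules is a $\sigma$-effectus, with unit object $M$ (with weight map the identity).
   Context: Countable means finite (possibly empty) or countably infinite. A partial commutative monoid (PCM) is a set $X$ with $0\in X$ and a partial binary operation $\oplus$ with $(x\oplus y)\oplus z=x\oplus(y\oplus z)$, $x\oplus y=y\oplus x$, $0\oplus x=x$, where ''$=$'' is Kleene equality (if either side is defined, so is the other, and they are equal); $x\perp y$ means $x\oplus y$ is defined. An effect algebra is a PCM $E$ with an element $1\in E$ such that for each $a\in E$ there is a unique $a^{\perp}\in E$ with $a\oplus a^{\perp}=1$, and $a\perp 1$ implies $a=0$; it is partially ordered by $a\le b$ iff $a\oplus c=b$ for some $c$. A $\sigma$-PAM is a nonempty set $M$ with a partial operation $\bigoplus$ sending countable families $(x_j)_{j\in J}$ in $M$ to elements of $M$ (a family is summable if its sum is defined), such that: (partition-associativity) for each countable family $(x_j)_{j\in J}$ and countable partition $J=\biguplus_{k\in K}J_k$, the family is summable iff each $(x_j)_{j\in J_k}$ is summable and $(\bigoplus_{j\in J_k}x_j)_{k\in K}$ is summable, and then $\bigoplus_{j\in J}x_j=\bigoplus_{k\in K}\bigoplus_{j\in J_k}x_j$; (unary sum) one-element families are summable with sum their element; (limit) a countable family is summable whenever all its finite subfamilies are. A $\sigma$-PAM is a PCM with $x_1\oplus x_2=\bigoplus_{i\in\{1,2\}}x_i$ and $0=\bigoplus\emptyset$. A map between $\sigma$-PAMs is $\sigma$-additive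 if it sends summable families to summable families and preserves their sums; $\sigma$-biadditive means $\sigma$-additive in each argument. A $\sigma$-PAC is a category $\mathbf{C}$ with countable coproducts (coprojections $\kappa_i$), all of whose homsets are $\sigma$-PAMs with $\sigma$-biadditive composition (so there are zero morphisms $0_{AB}$), such that: (compatible sum) every compatible countable family $(f_j\colon A\to B)_{j\in J}$ is summable in $\mathbf{C}(A,B)$; (untying) if $f,g\colon A\to B$ are summable then so are $\kappa_1\circ f,\kappa_2\circ g\colon A\to B+B$. Here $(f_j\colon A\to B_j)_{j\in J}$ is compatible if there is $f\colon A\to\coprod_{j}B_j$ with $\triangleright_j\circ f=f_j$ for all $j$, where the partial projection $\triangleright_i\colon\coprod_jB_j\to B_i$ is determined by $\triangleright_i\circ\kappa_i=\mathrm{id}$ and $\triangleright_i\circ\kappa_k=0$ for $k\ne i$. A $\sigma$-effectus is a $\sigma$-PAC $\mathbf{C}$ with a distinguished ''unit'' object $I$ such that: (i) for each $A$, the PCM $\mathbf{C}(A,I)$ is an effect algebra, with top written $\mathbf{1}_A$; (ii) $\mathbf{1}_B\circ f=0_{AI}$ implies $f=0_{AB}$ for all $f\colon A\to B$; (iii) $\mathbf{1}_B\circ f\perp\mathbf{1}_B\circ g$ implies $f\perp g$ for all $f,g\colon A\to B$. Asserting that a category is a $\sigma$-effectus includes the existence of a suitable $\sigma$-PAM structure on each homset. A $\sigma$-effect algebra is an effect algebra in which every increasing sequence has a supremum; it is a $\sigma$-PAM where a countable family is summable iff all its finite subfamilies are, and then $\bigoplus_{j\in J}x_j=\bigvee_{F\subseteq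 J\text{ finite}}\bigoplus_{j\in F}x_j$. A $\sigma$-effect monoid is a $\sigma$-effect algebra $M$ with an associative total $\sigma$-biadditive operation $\cdot\colon M\times M\to M$ with $a\cdot1=a=1\cdot a$. A $\sigma$-weight $M$-module is a $\sigma$-PAM $X$ with a $\sigma$-biadditive map $\cdot\colon M\times X\to X$ satisfying $1\cdot x=x$, $(r\cdot s)\cdot x=r\cdot(s\cdot x)$, and a $\sigma$-additive map $|-|\colon X\to M$ with $|r\cdot x|=r\cdot|x|$, such that $|x|=0$ implies $x=0$, and a countable family $(x_j)_{j}$ is summable in $X$ whenever $(|x_j|)_{j}$ is summable in $M$. $\boldsymbol{\sigma}\mathbf{WMod}_M$ is the category of $\sigma$-weight $M$-modules and $\sigma$-additive maps $f$ that preserve the action ($f(r\cdot x)=r\cdot f(x)$) and are weight-decreasing ($|f(x)|\le|x|$ for all $x$). *)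

(* Defs.v *)
From HB Require Import structures.
From mathcomp Require Import all_boot finmap boolp.

Set Implicit Arguments.
Unset Strict Implicit.
Unset Printing Implicit Defensive.

Local Open Scope fset_scope.

(* A partial operation is a total one into [option]; Kleene equality is then
   plain equality, and "is defined" is the coercion [isSome]. *)

Section OptOf.
Variables (X : Type) (P : X -> Prop).

Definition opt_of : option X :=
  if pselect (exists x, P x) is left e then Some (sval (cid e)) else None.

Lemma opt_ofP x :
  (forall y z, P y -> P z -> y = z) -> opt_of = Some x <-> P x.
Proof.
move=> uniqP; rewrite /opt_of; case: pselect => [e|ne]; last first.
  by split=> // Px; case: ne; exists x.
case: (cid e) => y Py /=; split=> [[<-] //|Px].
by rewrite (uniqP _ _ Py Px).
Qed.

Lemma opt_of_isSome : (exists x, P x) -> isSome opt_of.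
Proof. by rewrite /opt_of; case: pselect. Qed.
End OptOf.

Lemma eq_option (X : Type) (a b : option X) :
  (forall x, a = Some x <-> b = Some x) -> a = b.
Proof.
case: a => [a|] ab; first by rewrite ((ab a).1 erefl).
by case: b ab => // b ab; have := (ab b).2 erefl.
Qed.

Record pcm (X : Type) : Type := Pcm {
  pzero : X;
  padd : X -> X -> option X;
  paddA : forall x y z,
    obind (fun s => padd s z) (padd x y) = obind (padd x) (padd y z);
  paddC : forall x y, padd x y = padd y x;
  padd0 : forall x, padd pzero x = Some x }.

Definition perp (X : Type) (P : pcm X) (x y : X) : Prop := padd P x y.

Definition ple (X : Type) (P : pcm X) (x y : X) : Prop :=
  exists z, padd P x z = Some y.

Definition is_effect_algebra (X : Type) (P : pcm X) (one : X) : Prop :=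
  (forall a, exists! b, padd P a b = Some one) /\
  (forall a, perp P a one -> a = pzero P).

Definition is_sup (X : Type) (P : pcm X) (D : X -> Prop) (s : X) : Prop :=
  (forall d, D d -> ple P d s) /\
  (forall u, (forall d, D d -> ple P d u) -> ple P s u).

Section OptionMonoid.
Variables (X : Type) (P : pcm X).

Definition oadd (a b : option X) : option X :=
  obind (fun x => obind (padd P x) b) a.

Lemma oaddA : associative oadd.
Proof.
move=> [x|] [y|] [z|] //=; last by case: padd.
by rewrite -paddA; case: padd.
Qed.

Lemma oaddC : commutative oadd.
Proof. by move=> [x|] [y|] //=; rewrite paddC. Qed.

Lemma oadd0 : left_id (Some (pzero P)) oadd.
Proof. by case=> //= x; rewrite padd0. Qed.

HB.instance Definition _ := Monoid.isComLaw.Build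
  (option X) (Some (pzero P)) oadd oaddA oaddC oadd0.

Definition finsum (J : choiceType) (f : J -> X) (F : {fset J}) : option X :=
  \big[oadd/Some (pzero P)]_(j <- F) Some (f j).
End OptionMonoid.

(* Countable index sets are [countType]s; by [psum_bij] below the sum does not
   depend on the enumeration that such a type carries.  A partition of J into
   blocks indexed by K is a map p : J -> K; its blocks are the fibres of p,
   some of which may be empty. *)
Record sigmaPAM (X : Type) : Type := SigmaPAM {
  psum : forall J : countType, (J -> X) -> option X;
  pam_inhabited : inhabited X;
  psum_partition : forall (J K : countType) (p : J -> K) (f : J -> X) (x : X),
    psum f = Some x <->
    exists g : K -> X,
      (forall k, psum (fun j : {j : J | p j == k} => f (val j)) = Some (g k))
      /\ psum g = Some x;
  psum_unary : forall (J : countType) (j : J) (f : J -> X),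
    (forall i, i = j) -> psum f = Some (f j);
  psum_limit : forall (J : countType) (f : J -> X),
    (forall F : {fset J}, psum (fun j : F => f (val j))) -> psum f }.

Section PcmOfSigmaPAM.
Variables (X : Type) (P : sigmaPAM X).

Lemma psum_bij (J K : countType) (f : J -> X) (h : J -> K) (h' : K -> J) :
  cancel h h' -> cancel h' h -> psum P f = psum P (f \o h').
Proof.
move=> hK h'K; apply: eq_option => x; rewrite (psum_partition P h).
have fib k : psum P (fun j : {j : J | h j == k} => f (val j)) = Some (f (h' k)).
  have hk : h (h' k) == k by rewrite h'K.
  rewrite (psum_unary P (j := exist _ (h' k) hk)) //.
  by case=> j hj; apply: val_inj; rewrite /= -(eqP hj) hK.
split=> [[g [gE <-]]|fx]; last by exists (f \o h').
by congr psum; apply/funext => k /=; apply: Some_inj; rewrite -fib gE.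
Qed.

Lemma psum_void : exists z, psum P (of_void X) = Some z.
Proof.
have [x] := pam_inhabited P.
have /(psum_partition P (fun _ : unit => true)) :=
  psum_unary P (j := tt) (fun=> x) (fun i => match i with tt => erefl end).
case=> g [/(_ false) + _].
have v (j : {j : unit | true == false}) : void by case: j.
have v'K : cancel (fun a : void => of_void {j : unit | true == false} a) v by case.
have vK : cancel v (fun a => of_void _ a) by move=> j; case: (v j).
rewrite (psum_bij _ vK v'K) => E.
exists (g false); rewrite -E; congr psum.
by apply/funext; case.
Qed.

Definition pam_zero : X := sval (cid psum_void).

Lemma pam_zeroE : psum P (of_void X) = Some pam_zero.
Proof. by rewrite /pam_zero; case: cid. Qed.

Lemma psum_empty (J : countType) (f : J -> X) :
  (J -> void) -> psum P f = Some pam_zero.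
Proof.
move=> v; rewrite -pam_zeroE.
have vK : cancel v (of_void J) by move=> j; case: (v j).
have v'K : cancel (of_void J) v by case.
by rewrite (psum_bij _ vK v'K); congr psum; apply/funext; case.
Qed.

Definition pam_add (x y : X) : option X :=
  psum P (fun b : bool => if b then x else y).

Lemma psum_split (J : countType) (p : pred J) (f : J -> X) :
  psum P f = obind (fun s =>
      obind (pam_add s) (psum P (fun j : {j : J | p j == false} => f (val j))))
    (psum P (fun j : {j : J | p j == true} => f (val j))).
Proof.
apply: eq_option => x; rewrite (psum_partition P p); split.
  move=> [g [gE <-]]; rewrite !gE /= /pam_add; congr psum.
  by apply/funext; case.
case Ea: (psum P (fun j : {j | p j == true} => _)) => [a|] //=.
case Eb: (psum P (fun j : {j | p j == false} => _)) => [b|] //= E.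
by exists (fun c => if c then a else b); split=> //; case.
Qed.

Lemma pam_addC x y : pam_add x y = pam_add y x.
Proof.
rewrite /pam_add (psum_bij _ negbK negbK); congr psum.
by apply/funext; case.
Qed.

Lemma pam_add0 x : pam_add pam_zero x = Some x.
Proof.
have E : psum P (fun _ : unit => x) = Some x.
  by rewrite (psum_unary P (j := tt)) // => -[].
have v (j : {j : unit | false == true}) : void by case: j.
rewrite -[RHS]E (psum_split (fun=> false)) (psum_empty _ v).
by rewrite (psum_unary P (j := exist _ tt isT)) // => -[[] ?]; apply: val_inj.
Qed.

Lemma pam_addA x y z :
  obind (fun s => pam_add s z) (pam_add x y) = obind (pam_add x) (pam_add y z).
Proof.
pose f (o : option bool) := match o with
  Some true => x | Some false => y | None => z end.
transitivity (psum P f).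
  rewrite (psum_split isSome).
  rewrite (psum_unary P (j := exist _ None isT)); last first.
    by case=> -[b|] // ?; apply: val_inj.
  pose h (j : {j : option bool | isSome j == true}) := odflt true (val j).
  pose h' (b : bool) : {j : option bool | isSome j == true} :=
    exist _ (Some b) isT.
  have hK : cancel h h' by case=> -[b|] // ?; apply: val_inj.
  have h'K : cancel h' h by [].
  rewrite (psum_bij _ hK h'K) /pam_add; congr obind; congr psum.
rewrite (psum_split (pred1 (Some true))).
pose j0 : {j : option bool | (j == Some true) == true} := exist _ (Some true) isT.
rewrite (psum_unary P (j := j0)) /=; last first.
  by case=> -[[]|] // ?; apply: val_inj.
pose h (j : {j : option bool | (j == Some true) == false}) := isSome (val j).
pose h' (b : bool) : {j : option bool | (j == Some true) == false} :=
  if b then exist _ (Some false) isT else exist _ None isT.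
have hK : cancel h h' by case=> -[[]|] // ?; apply: val_inj.
have h'K : cancel h' h by case.
rewrite (psum_bij _ hK h'K) /pam_add; congr obind; congr psum.
by apply/funext; case.
Qed.

Definition pam_pcm : pcm X := Pcm pam_addA pam_addC pam_add0.
End PcmOfSigmaPAM.

Definition sigma_additive (X Y : Type) (P : sigmaPAM X) (Q : sigmaPAM Y)
    (f : X -> Y) : Prop :=
  forall (J : countType) (x : J -> X) (s : X),
    psum P x = Some s -> psum Q (fun j => f (x j)) = Some (f s).

Definition sigma_biadditive (X Y Z : Type) (P : sigmaPAM X) (Q : sigmaPAM Y)
    (R : sigmaPAM Z) (f : X -> Y -> Z) : Prop :=
  (forall x, sigma_additive Q R (f x)) /\
  (forall y, sigma_additive P R (fun x => f x y)).

Record sigmaEffectAlgebra : Type := SigmaEffectAlgebra {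
  sea_sort :> Type;
  sea_pcm : pcm sea_sort;
  sea_one : sea_sort;
  sea_axioms : is_effect_algebra sea_pcm sea_one;
  sea_sup : forall a : nat -> sea_sort,
    (forall n, ple sea_pcm (a n) (a n.+1)) ->
    exists s, is_sup sea_pcm (fun x => exists n, a n = x) s }.

Section SigmaEffectAlgebraPam.
Variable E : sigmaEffectAlgebra.
Implicit Types x y z s t : E.
Local Notation P := (sea_pcm E).
Local Notation "x <=' y" := (ple P x y) (at level 70).
Local Notation oadd := (oadd P).

Lemma oadd_Some (a b : option E) t : oadd a b = Some t ->
  exists x y, [/\ a = Some x, b = Some y & padd P x y = Some t].
Proof. by case: a b => [x|] [y|] //= xy; exists x, y. Qed.

Lemma padd_cancel x y z t : padd P x y = Some t -> padd P x z = Some t -> y = z.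
Proof.
move=> xy xz; have [/(_ t) [t' [tt' _]] _] := sea_axioms E.
have key w : padd P x w = Some t -> oadd (oadd (Some x) (Some t')) (Some w) =
    Some (sea_one E).
  by move=> xw; rewrite -oaddA [X in oadd _ X]oaddC oaddA /= xw /=.
have /oadd_Some[u [_ [xt' _ _]]] := key _ xy.
have [/(_ u) [v [_ uv]] _] := sea_axioms E.
have := key _ xy; have := key _ xz; rewrite xt' => /= uz uy.
by rewrite -(uv y) // -(uv z).
Qed.

Lemma padd_pos x y : padd P x y = Some (pzero P) -> x = pzero P.
Proof.
move=> xy; have [_ /(_ y) y1] := sea_axioms E.
suff y0 : y = pzero P by move: xy; rewrite y0 paddC padd0 => -[].
apply: y1; have := padd0 P (sea_one E).
have -> : padd P (pzero P) (sea_one E) =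
  oadd (oadd (Some x) (Some y)) (Some (sea_one E)) by rewrite /= xy.
by rewrite -oaddA => /oadd_Some[_ [u [_ /= + _]]]; rewrite /perp => ->.
Qed.

Lemma ple_refl x : x <=' x.
Proof. by exists (pzero P); rewrite paddC padd0. Qed.

Lemma ple_trans y x z : x <=' y -> y <=' z -> x <=' z.
Proof.
move=> [a xa] [b yb]; have : oadd (oadd (Some x) (Some a)) (Some b) = Some z.
  by rewrite /= xa.
by rewrite -oaddA => /oadd_Some[_ [c [[<-] _ xc]]]; exists c.
Qed.

Lemma ple_anti x y : x <=' y -> y <=' x -> x = y.
Proof.
move=> [a xa] [b yb].
have : oadd (Some x) (oadd (Some a) (Some b)) = Some x by rewrite oaddA /= xa.
move=> /oadd_Some[_ [c [[<-] ab xc]]].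
have c0 : c = pzero P by apply: padd_cancel xc _; rewrite paddC padd0.
have a0 : a = pzero P by apply: (@padd_pos _ b); rewrite -c0.
by move: xa; rewrite a0 paddC padd0 => -[].
Qed.

Lemma ple_add x y z : padd P x y = Some z -> x <=' z.
Proof. by exists y. Qed.

Lemma padd_mono x y x' y' z' : x <=' x' -> y <=' y' -> padd P x' y' = Some z' ->
  exists2 z, padd P x y = Some z & z <=' z'.
Proof.
move=> [a xa] [b yb] xy'.
have : oadd (oadd (Some x) (Some y)) (oadd (Some a) (Some b)) = Some z'.
  by rewrite Monoid.mulmACA /= xa yb.
by move=> /oadd_Some[z [c [xy _ zc]]]; exists z => //; exists c.
Qed.

Lemma sup_uniq D s t : is_sup P D s -> is_sup P D t -> s = t.
Proof. by move=> [sD Ds] [tD Dt]; apply: ple_anti; [apply: Ds|apply: Dt]. Qed.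

Lemma sup_add (D : E -> Prop) s c x : is_sup P D s -> (exists d, D d) ->
  (forall d, D d -> exists2 t, padd P d c = Some t & t <=' x) ->
  exists2 t, padd P s c = Some t & t <=' x.
Proof.
move=> [_ Ds] [d0 Dd0] Dx.
have [v cv] : c <=' x.
  have [t dc tx] := Dx _ Dd0; apply: ple_trans tx.
  by exists d0; rewrite paddC.
suff /padd_mono/(_ (ple_refl c)) : s <=' v by apply; rewrite paddC.
apply: Ds => d /Dx [t dc [w tw]]; exists w.
have : oadd (Some c) (oadd (Some d) (Some w)) = Some x.
  by rewrite oaddA (oaddC P (Some c)) /= dc.
move=> /oadd_Some[_ [v' [[<-] /= -> cv']]]; congr Some.
exact: padd_cancel cv' cv.
Qed.

Lemma finsumE (J : choiceType) (f : J -> E) (F : {fset J}) (s : seq J) :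
  uniq s -> F =i s -> finsum P f F = \big[oadd/Some (pzero P)]_(j <- s) Some (f j).
Proof. by move=> us Fs; apply/perm_big/uniq_perm => //; apply: fset_uniq. Qed.

Lemma finsumU (J : choiceType) (f : J -> E) (F G : {fset J}) :
  (forall j, j \in F -> j \notin G) ->
  finsum P f (F `|` G) = oadd (finsum P f F) (finsum P f G).
Proof.
move=> FG; rewrite -big_cat; apply: finsumE.
  rewrite cat_uniq !fset_uniq andbT /=; apply/hasPn => j jG.
  by apply/negP => /FG; rewrite jG.
by move=> j; rewrite inE mem_cat.
Qed.

Lemma finsum_subset (J : choiceType) (f : J -> E) (F G : {fset J}) t :
  F `<=` G -> finsum P f G = Some t ->
  exists2 s, finsum P f F = Some s & s <=' t.
Proof.
move=> FG; have GF : F `|` (G `\` F) = G.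
  by apply/fsetP => j; rewrite !inE; case: (boolP (j \in F)) => // /(fsubsetP FG) ->.
rewrite -{1}GF finsumU => [/oadd_Some[s [u [-> _ su]]]|j jF]; last by rewrite inE jF.
by exists s => //; exists u.
Qed.

Lemma bigoadd_mono (I : eqType) (r : seq I) (h : I -> option E) (g : I -> E) t :
  (forall k, k \in r -> exists2 s, h k = Some s & s <=' g k) ->
  \big[oadd/Some (pzero P)]_(k <- r) Some (g k) = Some t ->
  exists2 s, \big[oadd/Some (pzero P)]_(k <- r) h k = Some s & s <=' t.
Proof.
elim: r t => [|k r IH] t hg.
  by rewrite !big_nil => -[<-]; exists (pzero P) => //; apply: ple_refl.
rewrite !big_cons => /oadd_Some[_ [u [[<-] /IH[|s -> su]]]].
  by move=> i ir; apply: hg; rewrite inE ir orbT.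
by have [v -> vg] := hg k (mem_head _ _); apply: padd_mono.
Qed.

Section CountableSums.
Variable J : countType.
Implicit Types (f : J -> E) (F : {fset J}).

(* The supremum of the finite partial sums, when these are all defined; it then
   exists by [ea_psum_isSome]. *)
Definition ea_psum f : option E :=
  opt_of (fun x => (forall F, finsum P f F) /\
                   is_sup P (fun s => exists F, finsum P f F = Some s) x).

Lemma ea_psumP f x : ea_psum f = Some x <->
  (forall F, finsum P f F) /\ is_sup P (fun s => exists F, finsum P f F = Some s) x.
Proof. by apply: opt_ofP => y z [_ fy] [_ fz]; apply: sup_uniq fy fz. Qed.

Lemma ea_psum_isSome f : (forall F, finsum P f F) -> ea_psum f.
Proof.
move=> sf; apply: opt_of_isSome.
pose F n : {fset J} := [fset j in pmap (@pickle_inv J) (iota 0 n)].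
have memF n j : (j \in F n) = (choice.pickle j < n)%N.
  rewrite !inE mem_pmap; apply/mapP/idP => [[m]|jn].
    rewrite mem_iota => /= mn /esym mj.
    by have := @pickle_invK J m; rewrite mj /= => ->.
  by exists (choice.pickle j); rewrite ?mem_iota ?pickleK_inv.
pose a n := odflt (pzero P) (finsum P f (F n)).
have aE n : finsum P f (F n) = Some (a n).
  by rewrite /a; have := sf (F n); case: finsum.
have [n|s [as_ sa]] := sea_sup (a := a).
  have /finsum_subset/(_ (aE n.+1)) : F n `<=` F n.+1.
    by apply/fsubsetP => j; rewrite !memF; apply: ltnW.
  by rewrite aE => -[_ [<-]].
exists s; split=> //; split=> [d [G Gd]|u ub].
  have /finsum_subset/(_ (aE (\max_(j <- G) (choice.pickle j).+1)%N)) :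
      G `<=` F (\max_(j <- G) (choice.pickle j).+1)%N.
    by apply/fsubsetP => j jG; rewrite memF; apply: (leq_bigmax_seq (F := fun j => (choice.pickle j).+1)).
  rewrite Gd => -[_ [<-]] /ple_trans; apply; apply: as_.
  by exists (\max_(j <- G) (choice.pickle j).+1)%N.
by apply: sa => _ [n <-]; apply: ub; exists (F n).
Qed.

Lemma ea_psum_finite f F : (forall j, j \in F) -> ea_psum f = finsum P f F.
Proof.
move=> allF; apply: eq_option => x; rewrite ea_psumP.
have subF G : G `<=` F by apply/fsubsetP.
have supF t : finsum P f F = Some t ->
    is_sup P (fun s => exists G, finsum P f G = Some s) t.
  move=> Ft; split=> [d [G Gd]|u]; last by apply; exists F.
  by have [s] := finsum_subset (subF G) Ft; rewrite Gd => -[<-].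
split=> [[/(_ F)]|Fx].
  case Ft: (finsum P f F) => [t|] // _ fx; congr Some.
  exact: sup_uniq (supF _ Ft) fx.
split=> [G|]; last exact: supF.
by have [s ->] := finsum_subset (subF G) Fx.
Qed.
End CountableSums.

Lemma ea_psum_partition (J K : countType) (p : J -> K) (f : J -> E) x :
  ea_psum f = Some x <->
  exists g : K -> E,
    (forall k, ea_psum (fun j : {j : J | p j == k} => f (val j)) = Some (g k))
    /\ ea_psum g = Some x.
Proof.
pose val_fset k (H : {fset {j : J | p j == k}}) : {fset J} := [fset val j | j in H].
have finsum_val k (H : {fset {j : J | p j == k}}) :
    finsum P f (val_fset k H) = finsum P (fun j => f (val j)) H.
  rewrite (@finsumE _ _ _ (map val H)) ?big_map //.
    by rewrite map_inj_uniq ?fset_uniq //; apply: val_inj.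
  by move=> j; apply/imfsetP/mapP => -[i iH ->]; exists i.
have fib_le g x0 : 
    (forall k, ea_psum (fun j : {j : J | p j == k} => f (val j)) = Some (g k)) ->
    forall F : {fset J}, finsum P g [fset p j | j in F] = Some x0 ->
    exists2 s, finsum P f F = Some s & s <=' x0.
  move=> gE F; rewrite [finsum P f F](partition_big_imfset _ p) /=.
  apply: bigoadd_mono => k _.
  pose H : {fset {j : J | p j == k}} := [fset j in pmap insub F].
  have -> : \big[oadd/Some (pzero P)]_(i <- F | p i == k) Some (f i) =
      finsum P f (val_fset k H).
    rewrite -big_filter; apply/esym/finsumE; first by rewrite filter_uniq ?fset_uniq.
    move=> j; rewrite mem_filter; apply/imfsetP/andP => [[i /=]|[jk jF]].
      by rewrite inE mem_pmap_sub => iF ->; split=> //; apply: (valP i).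
    by exists (exist _ j jk) => //=; rewrite inE mem_pmap_sub.
  have /ea_psumP[/(_ H)] := gE k; rewrite finsum_val.
  case Hs: finsum => [s|] // _ [ub _]; exists s => //.
  by apply: ub; exists H.
have dir y : ea_psum f = Some y -> exists g : K -> E,
    (forall k, ea_psum (fun j : {j : J | p j == k} => f (val j)) = Some (g k))
    /\ ea_psum g = Some y.
  move=> /ea_psumP[sf [fy yf]].
  have sfib k : ea_psum (fun j : {j : J | p j == k} => f (val j)).
    by apply: ea_psum_isSome => H; rewrite -finsum_val.
  pose g k := odflt (pzero P) (ea_psum (fun j : {j : J | p j == k} => f (val j))).
  have gE k : ea_psum (fun j : {j : J | p j == k} => f (val j)) = Some (g k).
    by rewrite /g; have := sfib k; case: ea_psum.
  exists g; split=> //.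
  have claim (s : seq K) : uniq s -> forall F : {fset J},
      (forall j, j \in F -> p j \notin s) ->
      exists2 t, oadd (finsum P f F) (\big[oadd/Some (pzero P)]_(k <- s) Some (g k))
        = Some t & t <=' y.
    elim: s => [|k s IH] /= => [_ F _|/andP[ks us] F Fs].
      rewrite big_nil oaddC oadd0; have := sf F.
      by case Fd: finsum => [d|] // _; exists d => //; apply: fy; exists F.
    rewrite big_cons oaddA (oaddC P (finsum P f F)) -oaddA.
    have [|c cE _] := IH us F.
      by move=> j /Fs; rewrite inE negb_or => /andP[].
    rewrite cE /=; have /ea_psumP[_ gk] := gE k.
    apply: (sup_add gk); first by exists (pzero P), fset0; rewrite /finsum big_seq_fset0.
    move=> d [H Hd].
    have [|t tE ty] := IH us (val_fset k H `|` F).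
      move=> j; rewrite inE => /orP[/imfsetP[i _ ->]|/Fs].
        by rewrite (eqP (valP i)).
      by rewrite inE negb_or => /andP[].
    exists t => //; rewrite -tE finsumU ?finsum_val ?Hd.
      by rewrite -oaddA cE.
    move=> j /imfsetP[i _ ->]; apply/negP => /Fs.
    by rewrite (eqP (valP i)) mem_head.
  have gG (G : {fset K}) : exists2 t, finsum P g G = Some t & t <=' y.
    have [||t] := claim G _ fset0; rewrite ?fset_uniq //.
    by rewrite {1}/finsum big_seq_fset0 oadd0 => tE ty; exists t.
  apply/ea_psumP; split=> [G|]; first by have [t ->] := gG G.
  split=> [d [G Gd]|u ub]; first by have [t] := gG G; rewrite Gd => -[->].
  apply: yf => d [F Fd].
  have [t tE _] := gG [fset p j | j in F].
  have [s] := fib_le _ _ gE _ tE; rewrite Fd => -[<-] /ple_trans; apply.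
  by apply: ub; exists [fset p j | j in F].
split=> [/dir //|[g [gE gx]]].
have : ea_psum f.
  apply: ea_psum_isSome => F.
  have /ea_psumP[/(_ [fset p j | j in F])] := gx.
  by case tE: finsum => [t|] // _ _; have [s ->] := fib_le _ _ gE _ tE.
case fy: ea_psum => [y|] // _.
have [g' [g'E g'y]] := dir _ fy.
suff gg' : g = g' by rewrite -g'y -gg'.
by apply/funext => k; apply: Some_inj; rewrite -gE g'E.
Qed.

Lemma ea_psum_unary (J : countType) (j : J) (f : J -> E) :
  (forall i, i = j) -> ea_psum f = Some (f j).
Proof.
move=> allj; rewrite (@ea_psum_finite _ _ [fset j]) ?/finsum ?big_seq_fset1 //.
by move=> i; rewrite (allj i) inE.
Qed.

Lemma ea_psum_limit (J : countType) (f : J -> E) :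
  (forall F : {fset J}, ea_psum (fun j : F => f (val j))) -> ea_psum f.
Proof.
move=> sf; apply: ea_psum_isSome => F; have := sf F.
pose A : {fset F} := [fset i in enum (predT : {pred F})].
have allF (j : F) : j \in A by rewrite inE mem_enum.
rewrite (ea_psum_finite _ allF).
rewrite (@finsumE _ f F (map val A)) ?big_map //.
  by rewrite map_inj_uniq ?fset_uniq //; apply: val_inj.
move=> j; apply/idP/mapP => [jF|[i _ ->]]; last exact: valP.
by exists [` jF]; rewrite ?allF.
Qed.

Definition sea_pam : sigmaPAM E :=
  SigmaPAM (inhabits (sea_one E)) ea_psum_partition ea_psum_unary ea_psum_limit.
End SigmaEffectAlgebraPam.

Section SigmaEffectAlgebraPamFacts.
Variable E : sigmaEffectAlgebra.

Lemma sea_summableP (J : countType) (f : J -> E) :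
  psum (sea_pam E) f <-> forall F : {fset J}, finsum (sea_pcm E) f F.
Proof.
split=> [|sf]; last exact: ea_psum_isSome.
case fx: (psum _ f) => [x|] // _ F.
by have [-> _] := (ea_psumP f x).1 fx.
Qed.

Lemma sea_pam_zeroE : pam_zero (sea_pam E) = pzero (sea_pcm E).
Proof.
apply: Some_inj; rewrite -pam_zeroE /= (@ea_psum_finite _ _ _ fset0); last by case.
by rewrite /finsum big_seq_fset0.
Qed.

Lemma sea_pam_addE (x y : E) :
  padd (pam_pcm (sea_pam E)) x y = padd (sea_pcm E) x y.
Proof.
rewrite /= /pam_add /= (@ea_psum_finite _ _ _ [fset true; false]); last first.
  by case; rewrite !inE.
rewrite (@finsumE _ _ _ _ [:: true; false]) //; last by case; rewrite !inE.
by rewrite !big_cons big_nil (oaddC _ (Some y)) oadd0.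
Qed.
End SigmaEffectAlgebraPamFacts.

Record sigmaEffectMonoid : Type := SigmaEffectMonoid {
  sem_sea :> sigmaEffectAlgebra;
  sem_mul : sem_sea -> sem_sea -> sem_sea;
  sem_mulA : forall a b c, sem_mul a (sem_mul b c) = sem_mul (sem_mul a b) c;
  sem_mul_biadditive :
    sigma_biadditive (sea_pam sem_sea) (sea_pam sem_sea) (sea_pam sem_sea)
      sem_mul;
  sem_mul1l : forall a, sem_mul (sea_one sem_sea) a = a;
  sem_mul1r : forall a, sem_mul a (sea_one sem_sea) = a }.

Record category : Type := Category {
  obj :> Type;
  hom : obj -> obj -> Type;
  idm : forall A, hom A A;
  comp : forall A B C, hom B C -> hom A B -> hom A C;
  comp_idl : forall A B (f : hom A B), comp (idm B) f = f;
  comp_idr : forall A B (f : hom A B), comp f (idm A) = f;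
  compA : forall A B C D (h : hom C D) (g : hom B C) (f : hom A B),
    comp h (comp g f) = comp (comp h g) f }.

Arguments hom {c} A B.
Arguments idm {c} A.
Notation "g \oc f" := (comp g f) (at level 50, left associativity).

Record coproduct (C : category) (J : Type) (B : J -> C) : Type := Coproduct {
  cop_obj :> C;
  cop_in : forall j, hom (B j) cop_obj;
  cop_univ : forall (X : C) (g : forall j, hom (B j) X),
    exists! h : hom cop_obj X, forall j, h \oc cop_in j = g j }.

Arguments cop_in {C J B} c j.

Definition hom_pams (C : category) : Type :=
  forall A B : C, sigmaPAM (hom A B).

Section Compatible.
Variables (C : category) (H : hom_pams C) (J : countType).

(* By the universal property exactly one t satisfies this. *)
Definition is_partial_proj (B : J -> C) (S : coproduct B) (i : J)
    (t : hom S (B i)) : Prop :=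
  t \oc cop_in S i = idm (B i) /\
  forall k, k <> i -> t \oc cop_in S k = pam_zero (H (B k) (B i)).

Definition compatible (A : C) (B : J -> C) (S : coproduct B)
    (f : forall j, hom A (B j)) : Prop :=
  exists h : hom A S, forall j,
    exists2 t : hom S (B j), is_partial_proj t & t \oc h = f j.
End Compatible.

(* The coproducts are chosen; since they are unique up to isomorphism, the axioms
   do not depend on the choice. *)
Record sigmaPAC (C : category) : Type := SigmaPAC {
  pac_coprod : forall (J : countType) (B : J -> C), coproduct B;
  pac_pam : hom_pams C;
  pac_comp_biadditive : forall A B D : C,
    sigma_biadditive (pac_pam B D) (pac_pam A B) (pac_pam A D)
      (fun g f => g \oc f);
  pac_compatible_sum : forall (J : countType) (A B : C) (f : J -> hom A B),
    compatible pac_pam (pac_coprod (fun _ : J => B)) f ->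
    psum (pac_pam A B) f;
  pac_untying : forall (A B : C) (f g : hom A B),
    let BB := pac_coprod (fun _ : bool => B) in
    perp (pam_pcm (pac_pam A B)) f g ->
    perp (pam_pcm (pac_pam A BB)) (cop_in BB true \oc f) (cop_in BB false \oc g) }.

(* The homset sums are not part of the category: being a sigma-effectus asserts
   that suitable ones exist. *)
Definition is_sigma_effectus (C : category) (I : C) : Prop :=
  exists (P : sigmaPAC C) (one : forall A : C, hom A I),
  [/\ forall A : C, is_effect_algebra (pam_pcm (pac_pam P A I)) (one A),
      forall (A B : C) (f : hom A B),
        one B \oc f = pam_zero (pac_pam P A I) -> f = pam_zero (pac_pam P A B)
    & forall (A B : C) (f g : hom A B),
        perp (pam_pcm (pac_pam P A I)) (one B \oc f) (one B \oc g) ->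
        perp (pam_pcm (pac_pam P A B)) f g].

Record sigmaWMod (M : sigmaEffectMonoid) : Type := SigmaWMod {
  wm_sort :> Type;
  wm_pam : sigmaPAM wm_sort;
  wm_act : M -> wm_sort -> wm_sort;
  wm_act_biadditive : sigma_biadditive (sea_pam M) wm_pam wm_pam wm_act;
  wm_act1 : forall x, wm_act (sea_one M) x = x;
  wm_actA : forall r s x, wm_act (sem_mul r s) x = wm_act r (wm_act s x);
  weight : wm_sort -> M;
  weight_additive : sigma_additive wm_pam (sea_pam M) weight;
  weight_act : forall r x, weight (wm_act r x) = sem_mul r (weight x);
  weight_eq0 : forall x, weight x = pzero (sea_pcm M) -> x = pam_zero wm_pam;
  weight_summable : forall (J : countType) (x : J -> wm_sort),
    psum (sea_pam M) (fun j => weight (x j)) -> psum wm_pam x }.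

Section SigmaWModCategory.
Variable M : sigmaEffectMonoid.

Record sigmaWModHom (X Y : sigmaWMod M) : Type := SigmaWModHom {
  wmh_fun :> X -> Y;
  wmh_additive : sigma_additive (wm_pam X) (wm_pam Y) wmh_fun;
  wmh_act : forall r x, wmh_fun (wm_act r x) = wm_act r (wmh_fun x);
  wmh_weight : forall x, ple (sea_pcm M) (weight (wmh_fun x)) (weight x) }.

Lemma wmh_eq (X Y : sigmaWMod M) (f g : sigmaWModHom X Y) :
  (forall x, f x = g x) -> f = g.
Proof.
case: f g => [f fa fr fw] [g ga gr gw] /= /funext fg.
by subst g; congr SigmaWModHom; apply: Prop_irrelevance.
Qed.

Definition wmh_id (X : sigmaWMod M) : sigmaWModHom X X :=
  @SigmaWModHom X X id (fun J x s xs => xs) (fun r x => erefl)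
    (fun x => ple_refl (weight x)).

Lemma wmh_comp_additive (X Y Z : sigmaWMod M) (g : sigmaWModHom Y Z)
    (f : sigmaWModHom X Y) :
  sigma_additive (wm_pam X) (wm_pam Z) (fun x => g (f x)).
Proof. by move=> J x s /(wmh_additive f)/(wmh_additive g). Qed.

Lemma wmh_comp_act (X Y Z : sigmaWMod M) (g : sigmaWModHom Y Z)
    (f : sigmaWModHom X Y) r x : g (f (wm_act r x)) = wm_act r (g (f x)).
Proof. by rewrite !wmh_act. Qed.

Lemma wmh_comp_weight (X Y Z : sigmaWMod M) (g : sigmaWModHom Y Z)
    (f : sigmaWModHom X Y) x :
  ple (sea_pcm M) (weight (g (f x))) (weight x).
Proof. exact: ple_trans (wmh_weight g (f x)) (wmh_weight f x). Qed.

Definition wmh_comp (X Y Z : sigmaWMod M) (g : sigmaWModHom Y Z)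
    (f : sigmaWModHom X Y) : sigmaWModHom X Z :=
  SigmaWModHom (wmh_comp_additive g f) (wmh_comp_act g f) (wmh_comp_weight g f).

Definition sigmaWMod_cat : category :=
  @Category (sigmaWMod M) sigmaWModHom wmh_id wmh_comp
    (fun X Y f => @wmh_eq X Y (wmh_comp (wmh_id Y) f) f (fun=> erefl))
    (fun X Y f => @wmh_eq X Y (wmh_comp f (wmh_id X)) f (fun=> erefl))
    (fun X Y Z W h g f => @wmh_eq X W (wmh_comp h (wmh_comp g f))
      (wmh_comp (wmh_comp h g) f) (fun=> erefl)).

(* M acting on itself by multiplication, with the identity as weight map. *)
Definition sigmaWMod_unit : sigmaWMod M :=
  @SigmaWMod M M (sea_pam M) (@sem_mul M) (@sem_mul_biadditive M)
    (@sem_mul1l M) (fun r s x => esym (sem_mulA r s x))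
    id (fun J x s xs => xs) (fun r x => erefl)
    (fun x x0 => etrans x0 (esym (sea_pam_zeroE M))) (fun J x xs => xs).
End SigmaWModCategory.

(* Main.v *)
(* A family of morphisms X -> Y is summed pointwise.  Since a family in Y is
   summable as soon as its weights are, the family (f_j) is summable iff
   sum_j |f_j x| exists and is at most |x| for every x; compatible families,
   the two sides of untying, and axiom (iii) then concern the same weights.
   The coproduct of (B_j) consists of the tuples with summable weights, summed
   coordinatewise: exchanging double sums shows that such tuples are summable
   iff the double family of the weights of their coordinates is, and every
   tuple is the sum of the injections of its coordinates.  The top of
   Hom(A, M) is the weight of A, and the orthosupplement of a sends x to the
   difference |x| - a x, which is additive by cancellation in M. *)

From mathcomp Require Import all_boot finmap boolp.
Require Import Defs.

Set Implicit Arguments.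
Unset Strict Implicit.
Unset Printing Implicit Defensive.

Local Open Scope fset_scope.

(** * Reindexing, double sums and zeros in a sigma-PAM *)

Section SigmaPAMFacts.
Variables (X : Type) (P : sigmaPAM X).

(** Partition [K] into the image of [h] and its complement; the image block is summable and, by
    injectivity, a copy of [J]. *)
Lemma psum_sub (J K : countType) (h : J -> K) (f : K -> X) :
  injective h -> psum P f -> psum P (fun j => f (h j)).
Proof.
move=> inj_h; case Ef: (psum P f) => [x|] // _.
pose p k := `[< exists j, h j = k >].
have [g [/(_ true) gE _]] := (psum_partition P p f x).1 Ef.
have ph j : p (h j) == true by apply/eqP/asboolP; exists j.
pose h1 j : {k | p k == true} := exist _ (h j) (ph j).
have hP (k : {k | p k == true}) : exists j, h j = val k.
  by apply/asboolP/eqP; exact: (valP k).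
pose h2 k := sval (cid (hP k)).
have h2K : cancel h2 h1.
  by move=> k; apply: val_inj; rewrite /= /h2; case: cid.
have h1K : cancel h1 h2.
  by move=> j; apply: inj_h; rewrite /h2; case: cid.
by move: gE; rewrite (psum_bij _ _ h2K h1K) => /= ->.
Qed.

(** This is partition-associativity along the first projection, whose fibre over [k] is a copy of
    [J]. *)
Lemma psum_pair (K J : countType) (f : K -> J -> X) x :
  psum P (fun u : K * J => f u.1 u.2) = Some x <->
  exists g, (forall k, psum P (f k) = Some (g k)) /\ psum P g = Some x.
Proof.
rewrite (psum_partition P fst).
have fibE k : psum P (fun u : {u : K * J | u.1 == k} => f (val u).1 (val u).2) =
    psum P (f k).
  pose h (u : {u : K * J | u.1 == k}) := (val u).2.
  pose h' j : {u : K * J | u.1 == k} := exist _ (k, j) (eqxx k).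
  have hK : cancel h h'.
    by case=> -[a b] e; apply: val_inj => /=; congr pair; apply/esym/eqP.
  have h'K : cancel h' h by [].
  by rewrite (psum_bij _ _ hK h'K).
by split=> -[g [gE gx]]; exists g; split=> // k; rewrite -gE fibE.
Qed.

Lemma psum_exchange (K J : countType) (f : K -> J -> X) g x :
  (forall k, psum P (f k) = Some (g k)) -> psum P g = Some x ->
  exists h, (forall j, psum P (fun k => f k j) = Some (h j)) /\ psum P h = Some x.
Proof.
move=> fg gx; apply/psum_pair.
have swapK (A B : Type) : cancel (fun u : A * B => (u.2, u.1))
  (fun u => (u.2, u.1)) by case.
rewrite (psum_bij _ _ (swapK J K) (swapK K J)).
by apply/psum_pair; exists g.
Qed.

Lemma psum_zero (J : countType) :
  psum P (fun _ : J => pam_zero P) = Some (pam_zero P).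
Proof.
(* The empty family is cut into [J] many empty blocks, each of sum zero. *)
have [g [gE gx]] := (psum_partition P (of_void J) (of_void X) _).1 (pam_zeroE P).
rewrite -gx; congr psum; apply/funext => k; apply: Some_inj.
by rewrite -gE psum_empty //; case=> -[].
Qed.

(** Splitting off the index [j] leaves a family of zeros. *)
Lemma psum_delta (J : countType) (j : J) (f : J -> X) :
  (forall i, i != j -> f i = pam_zero P) -> psum P f = Some (f j).
Proof.
move=> f0; rewrite (psum_split P (pred1 j)).
pose j0 : {i : J | pred1 j i == true} := exist _ j (introT eqP (eqxx j)).
rewrite (psum_unary P (j := j0)) /=; last first.
  by case=> i ij; apply: val_inj => /=; apply/eqP; rewrite (eqP ij).
have -> : (fun i : {i | (i == j) == false} => f (val i)) = fun=> pam_zero P.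
  by apply/funext => -[i ij]; rewrite f0 //= (eqP ij).
by rewrite psum_zero /= pam_addC pam_add0.
Qed.

Lemma psum_bool (f : bool -> X) :
  psum P f = padd (pam_pcm P) (f true) (f false).
Proof. by rewrite /= /pam_add; congr psum; apply/funext; case. Qed.
End SigmaPAMFacts.

Lemma sigma_additive0 (X Y : Type) (P : sigmaPAM X) (Q : sigmaPAM Y) (f : X -> Y) :
  sigma_additive P Q f -> f (pam_zero P) = pam_zero Q.
Proof.
move=> /(_ _ _ _ (pam_zeroE P)); rewrite psum_empty; last by [].
by case.
Qed.

(** * Order bounds for countable sums in a sigma-effect algebra *)

Section SigmaEffectAlgebraFacts.
Variable E : sigmaEffectAlgebra.
Local Notation P := (sea_pam E).
Local Notation "x <=' y" := (ple (sea_pcm E) x y) (at level 70).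

Lemma ple_zero (x : E) : x <=' pzero (sea_pcm E) -> x = pzero (sea_pcm E).
Proof. by move=> [y /padd_pos]. Qed.

Lemma sea_summand (J : countType) (f : J -> E) s j :
  psum P f = Some s -> f j <=' s.
Proof.
move=> /ea_psumP[_ [ub _]]; apply: ub; exists [fset j].
by rewrite /finsum big_seq_fset1.
Qed.

(** Each finite partial sum of [f] exists below that of [g], hence below [t]; the supremum inherits
    the bound. *)
Lemma sea_psum_mono (J : countType) (f g : J -> E) t :
  (forall j, f j <=' g j) -> psum P g = Some t ->
  exists2 s, psum P f = Some s & s <=' t.
Proof.
move=> fg /ea_psumP[gfin [gt _]].
have ffin F : exists2 s, finsum (sea_pcm E) f F = Some s & s <=' t.
  case gF: (finsum (sea_pcm E) g F) (gfin F) => [u|] // _.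
  have [j _|s fF su] := bigoadd_mono (h := fun j => Some (f j)) _ gF.
    by exists (f j).
  by exists s => //; apply: ple_trans su _; apply: gt; exists F.
have : psum P f by apply/sea_summableP => F; have [s ->] := ffin F.
case fs: (psum P f) => [s|] // _; exists s => //.
move/ea_psumP: fs => [_ [_]]; apply=> d [F fF].
by have [s'] := ffin F; rewrite fF => -[->].
Qed.

Lemma sea_psum_fset (J : countType) (f : J -> E) (F : {fset J}) :
  psum P (fun j : F => f (val j)) = finsum (sea_pcm E) f F.
Proof.
rewrite /= (ea_psum_finite _ (F := [fset i in enum (predT : {pred F})])); last first.
  by move=> j; rewrite inE mem_enum.
rewrite [RHS]big_seq_fsetE /=; apply: finsumE; first exact: index_enum_uniq.
by move=> i; rewrite inE mem_enum mem_index_enum.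
Qed.

(** A sharpening of the limit axiom: a common bound on the finite sums passes to their supremum. It
    provides the weight bound in the limit axiom for homsets. *)
Lemma sea_psum_le (J : countType) (f : J -> E) t :
  (forall F : {fset J},
     exists2 s, psum P (fun j : F => f (val j)) = Some s & s <=' t) ->
  exists2 s, psum P f = Some s & s <=' t.
Proof.
move=> ffin; have : psum P f.
  by apply: psum_limit => F; have [s ->] := ffin F.
case fs: (psum P f) => [s|] // _; exists s => //.
move/ea_psumP: fs => [_ [_]]; apply=> d [F fF].
by have [s'] := ffin F; rewrite sea_psum_fset fF => -[->].
Qed.
End SigmaEffectAlgebraFacts.

(** * Homsets as sigma-PAMs under pointwise sums *)

Section Homs.
Variables (M : sigmaEffectMonoid) (X Y : sigmaWMod M).
Local Notation P := (sea_pam M).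
Local Notation "x <=' y" := (ple (sea_pcm M) x y) (at level 70).

Lemma weight_psum (J : countType) (y : J -> Y) t :
  psum P (fun j => weight (y j)) = Some t ->
  exists2 s, psum (wm_pam Y) y = Some s & weight s = t.
Proof.
move=> yt; have : psum (wm_pam Y) y by apply: weight_summable; rewrite yt.
case ys: (psum _ y) => [s|] // _; exists s => //.
by have := weight_additive ys; rewrite yt => -[].
Qed.

Lemma act_psumr (J : countType) (y : J -> Y) s (r : M) :
  psum (wm_pam Y) y = Some s ->
  psum (wm_pam Y) (fun j => wm_act r (y j)) = Some (wm_act r s).
Proof. exact: ((wm_act_biadditive Y).1 r). Qed.

(** Additivity is an exchange of the double sum of the [f j (x k)]; compatibility with the action
    follows from additivity of [wm_act r]. *)
Lemma pointwise_sum_hom (J : countType) (f : J -> sigmaWModHom X Y) (s : X -> Y) :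
  (forall x, psum (wm_pam Y) (fun j => f j x) = Some (s x)) ->
  (forall x, weight (s x) <=' weight x) ->
  exists h : sigmaWModHom X Y, forall x, h x = s x.
Proof.
move=> fs sw; suff sa : sigma_additive (wm_pam X) (wm_pam Y) s.
  suff sr r x : s (wm_act r x) = wm_act r (s x).
    by exists (SigmaWModHom sa sr sw).
  apply: Some_inj; rewrite -fs -(act_psumr r (fs x)); congr psum.
  by apply/funext => j; rewrite wmh_act.
move=> K x t xt.
have [h [hE <-]] := psum_exchange (fun j => wmh_additive (f j) xt) (fs t).
congr psum; apply/funext => k; apply: Some_inj.
by rewrite -fs hE.
Qed.

Definition hom_psum (J : countType) (f : J -> sigmaWModHom X Y) :
    option (sigmaWModHom X Y) :=
  opt_of (fun s : sigmaWModHom X Y =>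
    forall x, psum (wm_pam Y) (fun j => f j x) = Some (s x)).

Lemma hom_psumP (J : countType) (f : J -> sigmaWModHom X Y) s :
  hom_psum f = Some s <->
  forall x, psum (wm_pam Y) (fun j => f j x) = Some (s x).
Proof.
apply: opt_ofP => y z fy fz; apply: wmh_eq => x; apply: Some_inj.
by rewrite -fy fz.
Qed.

(** The sum on the left is the weight of the pointwise sum, so the bound says exactly that this sum
    is weight-decreasing. Summability of morphisms thus becomes a question about [M] alone. *)
Lemma hom_summableP (J : countType) (f : J -> sigmaWModHom X Y) :
  hom_psum f <->
  forall x, exists2 t, psum P (fun j => weight (f j x)) = Some t & t <=' weight x.
Proof.
split=> [|fw].
  case fs: (hom_psum f) => [s|] // _ x; exists (weight (s x)).
    by apply: weight_additive; move/hom_psumP: fs => ->.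
  exact: wmh_weight.
have /choice[s sP] x : exists s, psum (wm_pam Y) (fun j => f j x) = Some s /\
    weight s <=' weight x.
  by have [t /weight_psum[s fs <-] sx] := fw x; exists s.
have [h hs] := pointwise_sum_hom (fun x => (sP x).1) (fun x => (sP x).2).
suff -> : hom_psum f = Some h by [].
by apply/hom_psumP => x; rewrite hs (sP x).1.
Qed.

Lemma hom_psum_partition (J K : countType) (p : J -> K)
    (f : J -> sigmaWModHom X Y) s :
  hom_psum f = Some s <->
  exists g : K -> sigmaWModHom X Y,
    (forall k, hom_psum (fun j : {j : J | p j == k} => f (val j)) = Some (g k))
    /\ hom_psum g = Some s.
Proof.
split=> [/hom_psumP fs|[g [fg /hom_psumP gs]]]; last first.
  apply/hom_psumP => x; apply/(psum_partition _ p).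
  by exists (fun k => g k x); split=> // k; have /hom_psumP := fg k.
have /choice[g fg] k : exists g : sigmaWModHom X Y,
    hom_psum (fun j : {j : J | p j == k} => f (val j)) = Some g.
  suff : hom_psum (fun j : {j : J | p j == k} => f (val j)).
    by case: hom_psum => [g|] // _; exists g.
  apply/hom_summableP => x.
  (* The weight of a block sum at [x] is a summand of [weight (s x)], hence at most [weight x]. *)
  have [w [wE ws]] := (psum_partition P p _ _).1 (weight_additive (fs x)).
  exists (w k) => //; apply: ple_trans (wmh_weight s x).
  exact: sea_summand ws.
exists g; split=> //; apply/hom_psumP => x.
have [g' [g'E <-]] := (psum_partition _ p _ _).1 (fs x).
congr psum; apply/funext => k; apply: Some_inj; rewrite -g'E.
by have /hom_psumP/(_ x)-> := fg k.
Qed.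

Lemma hom_psum_unary (J : countType) (j : J) (f : J -> sigmaWModHom X Y) :
  (forall i, i = j) -> hom_psum f = Some (f j).
Proof.
by move=> allj; apply/hom_psumP => x; rewrite (psum_unary _ (j := j)).
Qed.

Lemma hom_psum_limit (J : countType) (f : J -> sigmaWModHom X Y) :
  (forall F : {fset J}, hom_psum (fun j : F => f (val j))) -> hom_psum f.
Proof.
move=> ffin; apply/hom_summableP => x; apply: sea_psum_le => F.
exact: (hom_summableP _).1.
Qed.

Lemma zero_hom_exists :
  exists z : sigmaWModHom X Y, forall x, z x = pam_zero (wm_pam Y).
Proof.
(* The zero map is the pointwise sum of the empty family. *)
apply: (@pointwise_sum_hom void (of_void _)) => x.
  by rewrite psum_empty.
rewrite (sigma_additive0 (@weight_additive _ Y)) sea_pam_zeroE.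
by exists (weight x); rewrite padd0.
Qed.

Definition hom_pam : sigmaPAM (sigmaWModHom X Y) :=
  SigmaPAM (let: ex_intro z _ := zero_hom_exists in inhabits z)
    hom_psum_partition hom_psum_unary hom_psum_limit.

Lemma hom_zeroE x : pam_zero hom_pam x = pam_zero (wm_pam Y).
Proof.
have /hom_psumP/(_ x) := pam_zeroE hom_pam.
by rewrite psum_empty; [case|].
Qed.
End Homs.

(** * Countable coproducts as direct sums of tuples with summable weights *)

Section DirectSum.
Variables (M : sigmaEffectMonoid) (J : countType) (B : J -> sigmaWMod M).
Local Notation P := (sea_pam M).
Local Notation "x <=' y" := (ple (sea_pcm M) x y) (at level 70).

Definition dsum : Type :=
  {x : forall j, B j | isSome (psum P (fun j => weight (x j)))}.

Definition Dsum (x : forall j, B j)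
    (w : isSome (psum P (fun j => weight (x j)))) : dsum :=
  exist (fun x : forall j, B j => isSome (psum P (fun j => weight (x j)))) x w.

Lemma dsum_eq (x y : dsum) : (forall j, val x j = val y j) -> x = y.
Proof. by move=> xy; apply/val_inj/functional_extensionality_dep. Qed.

Definition dsum_psum (K : countType) (x : K -> dsum) : option dsum :=
  opt_of (fun s : dsum =>
    forall j, psum (wm_pam (B j)) (fun k => val (x k) j) = Some (val s j)).

Lemma dsum_psumP (K : countType) (x : K -> dsum) s :
  dsum_psum x = Some s <->
  forall j, psum (wm_pam (B j)) (fun k => val (x k) j) = Some (val s j).
Proof.
apply: opt_ofP => y z xy xz; apply: dsum_eq => j; apply: Some_inj.
by rewrite -xy xz.
Qed.

(** Summing the double family first over [k] gives the weights of the coordinates of the sum;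
    summing first over [j] gives the weights of the tuples. As the criterion lives in [M], the
    partition and limit axioms can be drawn from those of [M]. *)
Lemma dsum_summableP (K : countType) (x : K -> dsum) :
  dsum_psum x <-> psum P (fun u : K * J => weight (val (x u.1) u.2)).
Proof.
split.
  case xs: (dsum_psum x) => [s|] // _; move/dsum_psumP: xs => xs.
  case st: (psum P _) (valP s) => [t|] // _.
  have [h [hE ht]] := psum_exchange (fun j => weight_additive (xs j)) st.
  suff -> : psum P (fun u : K * J => weight (val (x u.1) u.2)) = Some t by [].
  by apply/(psum_pair _ (fun k j => weight (val (x k) j))); exists h.
case xt: (psum P _) => [t|] // _.
have [g [xg gt]] := (psum_pair _ (fun k j => weight (val (x k) j)) _).1 xt.
have [h [hE ht]] := psum_exchange xg gt.
have sP j := cid2 (weight_psum (hE j)).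
pose s j : B j := sval (sP j).
have sE j : psum (wm_pam (B j)) (fun k => val (x k) j) = Some (s j).
  by rewrite /s; case: (sP j).
(* The coordinatewise sums form a tuple of [dsum] because their weights are the column sums [h],
   which are summable. *)
have sw : isSome (psum P (fun j => weight (s j))).
  have -> : (fun j => weight (s j)) = h.
    by apply/funext => j; rewrite /s; case: (sP j).
  by rewrite ht.
suff -> : dsum_psum x = Some (Dsum sw) by [].
exact/dsum_psumP.
Qed.

Lemma dsum_psum_partition (K L : countType) (p : K -> L) (x : K -> dsum) s :
  dsum_psum x = Some s <->
  exists g : L -> dsum,
    (forall l, dsum_psum (fun k : {k : K | p k == l} => x (val k)) = Some (g l))
    /\ dsum_psum g = Some s.
Proof.
split=> [xs|[g [xg /dsum_psumP gs]]]; last first.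
  apply/dsum_psumP => j; apply/(psum_partition _ p).
  by exists (fun l => val (g l) j); split=> // l; have /dsum_psumP := xg l.
have /choice[g xg] l : exists g : dsum,
    dsum_psum (fun k : {k : K | p k == l} => x (val k)) = Some g.
  suff : dsum_psum (fun k : {k : K | p k == l} => x (val k)).
    by case: dsum_psum => [g|] // _; exists g.
  apply/dsum_summableP.
  (* The double family of a block is an injectively indexed subfamily of the whole one. *)
  pose h (u : {k : K | p k == l} * J) := (val u.1, u.2).
  apply: (@psum_sub _ P _ _ h (fun u => weight (val (x u.1) u.2))).
    by move=> [a b] [a' b'] [/val_inj-> ->].
  by apply/dsum_summableP; rewrite xs.
exists g; split=> //; move/dsum_psumP: xs => xs; apply/dsum_psumP => j.
have [g' [g'E <-]] := (psum_partition _ p _ _).1 (xs j).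
congr psum; apply/funext => l; apply: Some_inj; rewrite -g'E.
by have /dsum_psumP/(_ j)-> := xg l.
Qed.

Lemma dsum_psum_unary (K : countType) (k : K) (x : K -> dsum) :
  (forall i, i = k) -> dsum_psum x = Some (x k).
Proof.
by move=> allk; apply/dsum_psumP => j; rewrite (psum_unary _ (j := k)).
Qed.

Lemma dsum_psum_limit (K : countType) (x : K -> dsum) :
  (forall F : {fset K}, dsum_psum (fun k : F => x (val k))) -> dsum_psum x.
Proof.
move=> xfin; apply/dsum_summableP/psum_limit => F.
(* A finite set [F] of pairs meets only finitely many rows, those in [G], so it embeds into [G * J],
   where the hypothesis applies. *)
pose G := [fset u.1 | u in F].
have FG (u : F) : (val u).1 \in G by apply: in_imfset (valP u).
pose h (u : F) : G * J := ([` FG u], (val u).2).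
apply: (@psum_sub _ P _ _ h (fun u => weight (val (x (val u.1)) u.2))).
  by move=> u v [uv1 uv2]; apply/val_inj/injective_projections.
exact: (dsum_summableP _).1 (xfin G).
Qed.

Lemma dsum_inhabited : inhabited dsum.
Proof.
suff w : isSome (psum P (fun j => weight (pam_zero (wm_pam (B j))))).
  by split; exists (fun j => pam_zero (wm_pam (B j))).
have -> : (fun j => weight (pam_zero (wm_pam (B j)))) = fun=> pam_zero P.
  by apply/funext => j; rewrite (sigma_additive0 (@weight_additive _ _)).
by rewrite psum_zero.
Qed.

Definition dsum_pam : sigmaPAM dsum :=
  SigmaPAM dsum_inhabited dsum_psum_partition dsum_psum_unary dsum_psum_limit.

Lemma dsum_zeroE j : val (pam_zero dsum_pam) j = pam_zero (wm_pam (B j)).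
Proof.
have /dsum_psumP/(_ j) := pam_zeroE dsum_pam.
by rewrite psum_empty; [case|].
Qed.

Lemma dsum_act_subproof (r : M) (x : dsum) :
  isSome (psum P (fun j => weight (wm_act r (val x j)))).
Proof.
case xt: (psum P _) (valP x) => [t|] // _.
have := (sem_mul_biadditive M).1 r _ _ _ xt.
by under eq_fun do rewrite -weight_act; move=> ->.
Qed.

Definition dsum_act (r : M) (x : dsum) : dsum := Dsum (dsum_act_subproof r x).

(** The default value is never reached, since tuples of [dsum] have summable weights. *)
Definition dsum_weight (x : dsum) : M :=
  odflt (sea_one M) (psum P (fun j => weight (val x j))).

Lemma dsum_weightE x : psum P (fun j => weight (val x j)) = Some (dsum_weight x).
Proof. by rewrite /dsum_weight; case: (psum P _) (valP x). Qed.

Lemma dsum_act_biadditive : sigma_biadditive P dsum_pam dsum_pam dsum_act.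
Proof.
split=> [r|x] K y s ys; apply/dsum_psumP => j /=.
  by apply: act_psumr; move/dsum_psumP: ys => ->.
exact: ((wm_act_biadditive (B j)).2 (val x j)).
Qed.

Lemma dsum_act1 x : dsum_act (sea_one M) x = x.
Proof. by apply: dsum_eq => j /=; rewrite wm_act1. Qed.

Lemma dsum_actA r s x : dsum_act (sem_mul r s) x = dsum_act r (dsum_act s x).
Proof. by apply: dsum_eq => j /=; rewrite wm_actA. Qed.

Lemma dsum_weight_additive : sigma_additive dsum_pam P dsum_weight.
Proof.
move=> K x s /dsum_psumP xs.
have [h [hE <-]] :=
  psum_exchange (fun j => weight_additive (xs j)) (dsum_weightE s).
congr psum; apply/funext => k; apply: Some_inj.
by rewrite -dsum_weightE hE.
Qed.

Lemma dsum_weight_act r x : dsum_weight (dsum_act r x) = sem_mul r (dsum_weight x).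
Proof.
apply: Some_inj; rewrite -dsum_weightE.
rewrite -((sem_mul_biadditive M).1 r _ _ _ (dsum_weightE x)).
by congr psum; apply/funext => j; rewrite /= weight_act.
Qed.

Lemma dsum_weight_ge x j : weight (val x j) <=' dsum_weight x.
Proof. exact: sea_summand (dsum_weightE x). Qed.

Lemma dsum_weight_eq0 x : dsum_weight x = pzero (sea_pcm M) -> x = pam_zero dsum_pam.
Proof.
move=> x0; apply: dsum_eq => j; rewrite dsum_zeroE; apply/weight_eq0/ple_zero.
by rewrite -x0; apply: dsum_weight_ge.
Qed.

Lemma dsum_weight_summable (K : countType) (x : K -> dsum) :
  psum P (fun k => dsum_weight (x k)) -> psum dsum_pam x.
Proof.
case xt: (psum P _) => [t|] // _; apply/dsum_summableP.
suff -> : psum P (fun u : K * J => weight (val (x u.1) u.2)) = Some t by [].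
apply/(psum_pair _ (fun k j => weight (val (x k) j))).
by exists (fun k => dsum_weight (x k)); split=> // k; apply: dsum_weightE.
Qed.

Definition dsum_wmod : sigmaWMod M :=
  SigmaWMod dsum_act_biadditive dsum_act1 dsum_actA dsum_weight_additive
    dsum_weight_act dsum_weight_eq0 dsum_weight_summable.

(** The fibres [B j] and [B i] are different types, so [b] is transported along [j = i]. Since [J]
    has decidable equality, such proofs are unique and the transport vanishes at [j] itself. *)
Definition inj_coord j (b : B j) i : B i :=
  match j =P i with
  | ReflectT e => eq_rect j (fun i => wm_sort (B i)) b i e
  | ReflectF _ => pam_zero (wm_pam (B i))
  end.

Lemma inj_coord_same j b : @inj_coord j b j = b.
Proof.
by rewrite /inj_coord; case: (j =P j) => // e; rewrite (eq_irrelevance e erefl).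
Qed.

Lemma inj_coord_diff j b i : i != j -> @inj_coord j b i = pam_zero (wm_pam (B i)).
Proof.
by move=> /eqP ij; rewrite /inj_coord; case: (j =P i) => // e; case: ij.
Qed.

Lemma inj_coord_weight j b :
  psum P (fun i => weight (@inj_coord j b i)) = Some (weight b).
Proof.
rewrite (psum_delta (j := j)) ?inj_coord_same // => i ij.
by rewrite inj_coord_diff // (sigma_additive0 (@weight_additive _ _)).
Qed.

Lemma dsum_inj_subproof j b : isSome (psum P (fun i => weight (@inj_coord j b i))).
Proof. by rewrite inj_coord_weight. Qed.

Definition dsum_inj_fun j (b : B j) : dsum := Dsum (dsum_inj_subproof b).

Lemma dsum_inj_additive j :
  sigma_additive (wm_pam (B j)) dsum_pam (@dsum_inj_fun j).
Proof.
move=> K x s xs; apply/dsum_psumP => i /=; case: (eqVneq i j) => [->|ij].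
  rewrite inj_coord_same -xs; congr psum.
  by apply/funext => k; rewrite inj_coord_same.
rewrite inj_coord_diff // -(psum_zero _ K); congr psum.
by apply/funext => k; rewrite inj_coord_diff.
Qed.

Lemma act_zero (X : sigmaWMod M) r :
  wm_act r (pam_zero (wm_pam X)) = pam_zero (wm_pam X).
Proof. exact: sigma_additive0 ((wm_act_biadditive X).1 r). Qed.

Lemma dsum_inj_act j r b : @dsum_inj_fun j (wm_act r b) = dsum_act r (dsum_inj_fun b).
Proof.
apply: dsum_eq => i /=; case: (eqVneq i j) => [->|ij].
  by rewrite !inj_coord_same.
by rewrite !inj_coord_diff // act_zero.
Qed.

Lemma dsum_inj_weight j b : dsum_weight (@dsum_inj_fun j b) = weight b.
Proof. by apply: Some_inj; rewrite -dsum_weightE inj_coord_weight. Qed.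

Lemma dsum_inj_weight_le j b : dsum_weight (@dsum_inj_fun j b) <=' weight b.
Proof. by rewrite dsum_inj_weight; apply: ple_refl. Qed.

Definition dsum_inj j : sigmaWModHom (B j) dsum_wmod :=
  @SigmaWModHom M (B j) dsum_wmod (@dsum_inj_fun j) (@dsum_inj_additive j)
    (@dsum_inj_act j) (@dsum_inj_weight_le j).

Lemma dsum_decomp (x : dsum_wmod) :
  psum (wm_pam dsum_wmod) (fun j => dsum_inj j (val x j)) = Some x.
Proof.
apply/dsum_psumP => j; rewrite (psum_delta (j := j)) /= ?inj_coord_same // => i ij.
by rewrite inj_coord_diff // eq_sym.
Qed.

(** A morphism is thus determined by its restrictions to the summands; this yields uniqueness of
    cotuples and identifies the partial projections. *)
Lemma hom_dsumE (X : sigmaWMod M) (h : sigmaWModHom dsum_wmod X) x :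
  psum (wm_pam X) (fun j => h (dsum_inj j (val x j))) = Some (h x).
Proof. exact: wmh_additive (dsum_decomp x). Qed.

(** The cotuple sends [x] to the sum of the [g j (val x j)]. This sum exists and has weight at most
    that of [x], because each [g j] decreases weights and the coordinate weights of [x] are
    summable. *)
Lemma dsum_cotuple (X : sigmaWMod M) (g : forall j, sigmaWModHom (B j) X) :
  exists h : sigmaWModHom dsum_wmod X, forall j b, h (dsum_inj j b) = g j b.
Proof.
have /choice[h hP] (x : dsum_wmod) : exists s,
    psum (wm_pam X) (fun j => g j (val x j)) = Some s /\ weight s <=' weight x.
  have [t /weight_psum[s gs <-] sx] :=
    sea_psum_mono (fun j => wmh_weight (g j) (val x j)) (dsum_weightE x).
  by exists s.
have ha : sigma_additive dsum_pam (wm_pam X) h.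
  move=> K x s /dsum_psumP xs.
  have [u [uE <-]] :=
    psum_exchange (fun j => wmh_additive (g j) (xs j)) (hP s).1.
  by congr psum; apply/funext => k; apply: Some_inj; rewrite -(hP _).1 uE.
have hr r x : h (dsum_act r x) = wm_act r (h x).
  apply: Some_inj; rewrite -(hP _).1 -(act_psumr r (hP x).1); congr psum.
  by apply/funext => j /=; rewrite wmh_act.
exists (@SigmaWModHom M dsum_wmod X h ha hr (fun x => (hP x).2)) => j b.
apply: Some_inj; rewrite /= -(hP _).1 (psum_delta (j := j)) /= ?inj_coord_same //.
by move=> i ij; rewrite inj_coord_diff // (sigma_additive0 (wmh_additive _)).
Qed.

Lemma dsum_univ (X : sigmaWMod_cat M) (g : forall j, hom (B j : sigmaWMod_cat M) X) :
  exists! h : hom (dsum_wmod : sigmaWMod_cat M) X,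
    forall j, comp (c := sigmaWMod_cat M) h (dsum_inj j) = g j.
Proof.
have [h hg] := dsum_cotuple g.
exists h; split=> [j|h' h'g]; first by apply: wmh_eq => b; apply: hg.
apply: wmh_eq => x; apply: Some_inj; rewrite -!hom_dsumE; congr psum.
by apply/funext => j; rewrite hg -h'g.
Qed.

Definition dsum_coprod : coproduct (C := sigmaWMod_cat M) B :=
  @Coproduct (sigmaWMod_cat M) J B dsum_wmod dsum_inj dsum_univ.

Lemma partial_projE i (t : sigmaWModHom dsum_wmod (B i)) x :
  is_partial_proj (C := sigmaWMod_cat M) (@hom_pam M) (S := dsum_coprod) t ->
  t x = val x i.
Proof.
(* In the decomposition of [t x] along the injections, only the term at [i] is nonzero. *)
move=> [ti t0]; apply: Some_inj; rewrite -hom_dsumE (psum_delta (j := i)).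
  by have /(congr1 (fun h : sigmaWModHom _ _ => h (val x i))) /= -> := ti.
move=> k /eqP ki.
have /(congr1 (fun h : sigmaWModHom _ _ => h (val x k))) /= -> := t0 k ki.
exact: hom_zeroE.
Qed.
End DirectSum.

(** * The sigma-PAC axioms and the effect algebra of morphisms into the unit *)

Section Effectus.
Variable M : sigmaEffectMonoid.
Local Notation P := (sea_pam M).
Local Notation C := (sigmaWMod_cat M).
Local Notation "x <=' y" := (ple (sea_pcm M) x y) (at level 70).

Lemma comp_biadditive (A B D : C) :
  sigma_biadditive (@hom_pam M B D) (@hom_pam M A B) (@hom_pam M A D)
    (fun g f => comp (c := C) g f).
Proof.
split=> [g|f] K h s /hom_psumP hs; apply/hom_psumP => x /=.
  exact/wmh_additive/hs.
exact: hs.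
Qed.

Lemma compatible_sum (J : countType) (A B : C) (f : J -> hom A B) :
  compatible (C := C) (@hom_pam M) (dsum_coprod (fun _ : J => B)) f ->
  psum (@hom_pam M A B) f.
Proof.
move=> [h hf]; apply/hom_summableP => x; exists (weight (h x)); last exact: wmh_weight.
(* The [f j x] are the coordinates of the tuple [h x], so their weights sum to its weight. *)
rewrite -dsum_weightE; congr psum; apply/funext => j.
by have [t tp <-] := hf j; rewrite /= (partial_projE _ tp).
Qed.

Lemma untying (A B : C) (f g : hom A B) :
  let BB := dsum_coprod (fun _ : bool => B) in
  perp (pam_pcm (@hom_pam M A B)) f g ->
  perp (pam_pcm (@hom_pam M A (BB : C)))
    (comp (cop_in BB true) f) (comp (cop_in BB false) g).
Proof.
move=> BB /hom_summableP fg; apply/hom_summableP => x.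
have [t ft tx] := fg x; exists t => //; rewrite -ft; congr psum.
(* The coprojections preserve weights, so both sides of untying have the same weight family. *)
by apply/funext => -[] /=; apply: dsum_inj_weight.
Qed.

Definition sigmaWMod_pac : sigmaPAC C :=
  @SigmaPAC C (@dsum_coprod M) (@hom_pam M) comp_biadditive compatible_sum untying.

Definition weight_hom (A : sigmaWMod M) : sigmaWModHom A (sigmaWMod_unit M) :=
  @SigmaWModHom M A (sigmaWMod_unit M) (@weight M A) (@weight_additive M A)
    (@weight_act M A) (fun x => ple_refl (weight x)).

Lemma hom_paddP (A B : sigmaWMod M) (f g s : sigmaWModHom A B) :
  padd (pam_pcm (hom_pam A B)) f g = Some s <->
  forall x, padd (pam_pcm (wm_pam B)) (f x) (g x) = Some (s x).
Proof.
(* The binary sum is by definition the sum indexed by [bool]. *)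
rewrite -[padd _ _ _]/(hom_psum _) hom_psumP.
by split=> fg x; have := fg x; rewrite psum_bool.
Qed.

Lemma weight_complement (A : sigmaWMod M) (a : sigmaWModHom A (sigmaWMod_unit M)) :
  exists b : sigmaWModHom A (sigmaWMod_unit M),
    forall x, padd (sea_pcm M) (a x) (b x) = Some (weight x).
Proof.
have /choice[b ab] x : exists y, padd (sea_pcm M) (a x) y = Some (weight x).
  (* [ple] asserts that a difference exists, and the unit has the identity as weight. *)
  exact: wmh_weight a x.
have ab' x : psum P (fun i : bool => if i then a x else b x) = Some (weight x).
  by rewrite psum_bool sea_pam_addE ab.
have bw x : b x <=' weight x by exists (a x); rewrite paddC ab.
have ba : sigma_additive (wm_pam A) P b.
  move=> J x s xs.
  have [t bt _] := sea_psum_mono (fun j => bw (x j)) (weight_additive xs).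
  (* Exchanging sums, the sum of the [a (x j)] plus the sum [t] of the [b (x j)] is [weight s],
     which is also [a s] plus [b s]. As the first sum is [a s], cancellation gives [t = b s]. *)
  have [u [uE us]] := psum_exchange (fun j => ab' (x j)) (weight_additive xs).
  rewrite bt; congr Some; apply: padd_cancel _ (ab s).
  rewrite -us psum_bool sea_pam_addE; congr padd; apply: Some_inj.
    by rewrite -(wmh_additive a xs) -uE.
  by rewrite -bt -uE.
have br r x : b (wm_act r x) = sem_mul r (b x).
  (* Multiplying the decomposition of [weight x] by [r] gives one of [weight (wm_act r x)] with the
     same first term [a (wm_act r x)], which cancels. *)
  apply: padd_cancel (ab _) _; rewrite wmh_act (weight_act r x) -sea_pam_addE.
  rewrite -((sem_mul_biadditive M).1 r _ _ _ (ab' x)).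
  by rewrite psum_bool.
by exists (@SigmaWModHom M A (sigmaWMod_unit M) b ba br bw).
Qed.

Lemma hom_unit_effect_algebra (A : sigmaWMod M) :
  is_effect_algebra (pam_pcm (hom_pam A (sigmaWMod_unit M))) (weight_hom A).
Proof.
split=> [a|a].
  have [b ab] := weight_complement a.
  exists b; split=> [|c /hom_paddP ac].
    by apply/hom_paddP => x; rewrite sea_pam_addE.
  apply: wmh_eq => x; apply: padd_cancel (ab x) _.
  by rewrite -sea_pam_addE ac.
rewrite /perp; case as_: (padd _ a _) => [s|] // _; apply: wmh_eq => x.
rewrite hom_zeroE /= sea_pam_zeroE; move/hom_paddP/(_ x): as_.
rewrite sea_pam_addE /= paddC => wax.
(* Now [weight x] plus [a x] equals [s x], so [weight x] is below [s x]; as [s] decreases weights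
   they agree, and cancellation forces [a x] to be zero. *)
have ws : weight x = s x by apply: ple_anti; [exists (a x)|exact: (wmh_weight s x)].
by apply: padd_cancel wax _; rewrite paddC padd0 ws.
Qed.
End Effectus.

Theorem proposition65 (M : sigmaEffectMonoid) :
  is_sigma_effectus (C := sigmaWMod_cat M) (sigmaWMod_unit M).
Proof.
exists (sigmaWMod_pac M), (@weight_hom M); split=> [A|A B f f0|A B f g fg].
- exact: hom_unit_effect_algebra.
- apply: wmh_eq => x; rewrite [RHS]hom_zeroE; apply: weight_eq0.
  have /(congr1 (fun h : sigmaWModHom _ _ => h x)) := f0.
  by rewrite [RHS]hom_zeroE [RHS]sea_pam_zeroE.
(* Postcomposing with the top takes weights, and the weight on the unit is the identity, so both
   summability criteria concern the same family and bound. *)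
- apply/hom_summableP => x; have [t ft tx] := (hom_summableP _).1 fg x.
  by exists t => //; rewrite -ft; congr psum; apply/funext => -[].
Qed.
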